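(* Let $p$ be a prime, let $0,\alpha,\beta$ be distinct integers, and let $R=\mathbb{Z}_p[x]/x(x-\alpha)(x-\beta)\mathbb{Z}_p[x]$. If $([\alpha],[\beta],[\beta-\alpha])=(0,0,k)$, then, writing $x=p^{-s}$, $$\zeta_R(s)=\frac{1-p^kx^{2k}}{1-px^2}\cdot\frac{1}{(1-x)^2}+\frac{p^kx^{2k}}{(1-x)^3}.$$
   Context: $\mathbb{Z}_p=\{a/b\mid a,b\in\mathbb{Z},\ p\nmid b\}$ is the localization of $\mathbb{Z}$ at $p$. For nonzero $a\in\mathbb{Z}_p$, $[a]$ is the unique non-negative integer $r$ with $a\mathbb{Z}_p=p^r\mathbb{Z}_p$. $\zeta_R(s)=\sum_I |R:I|^{-s}$, where $I$ runs over the full ideals of $R$ (ideals of finite index), viewed as a formal power series in $p^{-s}$. In the formula $x$ denotes $p^{-s}$ (not the polynomial variable). *)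

(* Defs.v *)
From HB Require Import structures.
From mathcomp Require Import all_boot all_order all_algebra.
From mathcomp Require Import finmap boolp classical_sets functions cardinality.

Set Implicit Arguments.
Unset Strict Implicit.
Unset Printing Implicit Defensive.

Import Order.TTheory GRing.Theory Num.Theory.

Local Open Scope fset_scope.
Local Open Scope ring_scope.
Local Open Scope classical_set_scope.

Reserved Notation "{ 'fps' R }" (format "{ 'fps'  R }").

(** * Formal power series in one variable *)

Record fps (R : comNzRingType) := Fps { fps_coef : nat -> R }.

Notation "{ 'fps' R }" := (fps R) : type_scope.

Section FpsRing.
Variable R : comNzRingType.
Implicit Types f g h : {fps R}.

Lemma fps_coefK : cancel (@fps_coef R) (@Fps R). Proof. by case. Qed.

HB.instance Definition _ := Choice.copy {fps R} (can_type fps_coefK).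

Lemma fpsP f g : (forall n, fps_coef f n = fps_coef g n) -> f = g.
Proof. by move=> fg; apply: (can_inj fps_coefK); apply/funext. Qed.

Definition fps_zero : {fps R} := Fps (fun=> 0).
Definition fps_opp f : {fps R} := Fps (fun n => - fps_coef f n).
Definition fps_add f g : {fps R} := Fps (fun n => fps_coef f n + fps_coef g n).

Lemma fps_addA : associative fps_add.
Proof. by move=> f g h; apply: fpsP => n; rewrite /= addrA. Qed.
Lemma fps_addC : commutative fps_add.
Proof. by move=> f g; apply: fpsP => n; rewrite /= addrC. Qed.
Lemma fps_add0 : left_id fps_zero fps_add.
Proof. by move=> f; apply: fpsP => n; rewrite /= add0r. Qed.
Lemma fps_addN : left_inverse fps_zero fps_opp fps_add.
Proof. by move=> f; apply: fpsP => n; rewrite /= addNr. Qed.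

HB.instance Definition _ :=
  GRing.isZmodule.Build {fps R} fps_addA fps_addC fps_add0 fps_addN.

Definition fps_one : {fps R} := Fps (fun n => (n == 0)%:R).
Definition fps_mul f g : {fps R} :=
  Fps (fun n => \sum_(i < n.+1) fps_coef f i * fps_coef g (n - i)%N).

Definition fps_trunc N f : {poly R} := \poly_(i < N) fps_coef f i.

Lemma fps_mul_trunc N f g n : (n < N)%N ->
  fps_coef (fps_mul f g) n = (fps_trunc N f * fps_trunc N g)`_n.
Proof.
move=> nN; rewrite coefM /=; apply: eq_bigr => i _.
by rewrite !coef_poly (leq_ltn_trans _ nN) ?leq_ord // (leq_ltn_trans _ nN) ?leq_subr.
Qed.

Lemma fps_mulA : associative fps_mul.
Proof.
move=> f g h; apply: fpsP => n; set tr := fps_trunc n.+1.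
transitivity ((tr f * (tr g * tr h))`_n); last first.
  rewrite mulrA coefM /=; apply: eq_bigr => i _.
  by rewrite -(@fps_mul_trunc n.+1) ?ltn_ord // coef_poly ltnS leq_subr.
rewrite coefM /=; apply: eq_bigr => i _.
rewrite -[X in _ = _ * X](@fps_mul_trunc n.+1) ?ltnS ?leq_subr //.
by rewrite coef_poly ltn_ord.
Qed.

Lemma fps_mulC : commutative fps_mul.
Proof.
by move=> f g; apply: fpsP => n; rewrite !(@fps_mul_trunc n.+1) // mulrC.
Qed.

Lemma fps_mul1 : left_id fps_one fps_mul.
Proof.
move=> f; apply: fpsP => n /=; rewrite big_ord_recl /= mul1r subn0 big1 ?addr0 //.
by move=> i _; rewrite mul0r.
Qed.

Lemma fps_mulDl : left_distributive fps_mul fps_add.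
Proof.
move=> f g h; apply: fpsP => n /=; rewrite -big_split /=.
by apply: eq_bigr => i _; rewrite mulrDl.
Qed.

Lemma fps_one_neq0 : fps_one != fps_zero.
Proof.
apply/eqP => /(congr1 (fun f => fps_coef f 0%N))/= /eqP.
by rewrite oner_eq0.
Qed.

HB.instance Definition _ := GRing.Zmodule_isComNzRing.Build {fps R}
  fps_mulA fps_mulC fps_mul1 fps_mulDl fps_one_neq0.

(* As for every [unitRingType], a non-invertible [f] has [f^-1 = f]; see
   [unit_fps] below for the series that are invertible. *)
Definition fps_unit : pred {fps R} := fun f => `[< exists g, g * f = 1 >].

Definition fps_inv f : {fps R} :=
  if pselect (exists g, g * f = 1) is left fV then projT1 (cid fV) else f.

Lemma fps_mulVf : {in fps_unit, left_inverse 1 fps_inv *%R}.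
Proof.
by move=> f /asboolP fU; rewrite /fps_inv; case: pselect => // ?; case: cid.
Qed.

Lemma fps_unitP f g : g * f = 1 -> fps_unit f.
Proof. by move=> gf1; apply/asboolP; exists g. Qed.

Lemma fps_inv_out : {in [predC fps_unit], fps_inv =1 id}.
Proof. by move=> f /asboolPn fU; rewrite /fps_inv; case: pselect. Qed.

HB.instance Definition _ := GRing.ComNzRing_hasMulInverse.Build {fps R}
  fps_mulVf fps_unitP fps_inv_out.

End FpsRing.

Definition fpsX (R : comNzRingType) : {fps R} := Fps (fun n => (n == 1)%:R).

Section FpsUnit.
Variables (R : comUnitRingType) (f : {fps R}).

Fixpoint fps_inv_coefs n : seq R :=
  if n is m.+1 then
    let s := fps_inv_coefs m in
    rcons s ((fps_coef f 0)^-1 *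
             ((m == 0)%:R - \sum_(i < m) s`_i * fps_coef f (m - i)))
  else [::].

Lemma size_fps_inv_coefs n : size (fps_inv_coefs n) = n.
Proof. by elim: n => //= n IHn; rewrite size_rcons IHn. Qed.

Lemma nth_fps_inv_coefs n i :
  (i < n)%N -> (fps_inv_coefs n)`_i = (fps_inv_coefs i.+1)`_i.
Proof.
elim: n => // n IHn; rewrite ltnS leq_eqVlt => /predU1P[-> //|lt_in].
by rewrite [LHS]nth_rcons size_fps_inv_coefs lt_in IHn.
Qed.

Lemma unit_fps : fps_coef f 0 \is a GRing.unit -> f \is a GRing.unit.
Proof.
move=> f0U; apply/asboolP; exists (Fps (fun n => (fps_inv_coefs n.+1)`_n)).
apply: fpsP => n; rewrite [LHS]big_ord_recr /= subnn.
rewrite nth_rcons size_fps_inv_coefs ltnn eqxx mulrAC mulVr // mul1r addrC.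
rewrite -[RHS](subrK (\sum_(i < n) (fps_inv_coefs n)`_i * fps_coef f (n - i))).
congr (_ + _); apply: eq_bigr => i _; congr (_ * _).
by rewrite -[LHS](@nth_fps_inv_coefs n).
Qed.

End FpsUnit.

(** * The localization of the integers at a prime *)

Section Localization.
Variables (p : nat) (p_pr : prime p).

Definition zloc_pred of prime p : {pred rat} :=
  fun q => `[< exists a b : int, ~~ (p %| b)%Z /\ q = a%:Q / b%:Q >].

Lemma zloc_predP q :
  reflect (exists a b : int, ~~ (p %| b)%Z /\ q = a%:Q / b%:Q)
          (q \in zloc_pred p_pr).
Proof. exact: asboolP. Qed.

Lemma zloc_subring_closed : subring_closed (zloc_pred p_pr).
Proof.
have ndvd_neq0 (b : int) : ~~ (p %| b)%Z -> b%:Q != 0.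
  by apply: contraNneq => /eqP; rewrite intr_eq0 => /eqP ->; rewrite dvdz0.
have ndvdM (b d : int) :
    ~~ (p %| b)%Z -> ~~ (p %| d)%Z -> ~~ (p %| b * d)%Z.
  by rewrite !dvdzE abszM Euclid_dvdM // negb_or => -> ->.
split=> [|q r|q r].
- by apply/zloc_predP; exists 1, 1; rewrite dvdzE dvdn1 gtn_eqF ?prime_gt1.
- move=> /zloc_predP[a [b [pb ->]]] /zloc_predP[c [d [pd ->]]].
  apply/zloc_predP; exists (a * d - c * b), (b * d); split; first exact: ndvdM.
  by rewrite rmorphB !rmorphM /= -mulNr -[in LHS]mulNr addf_div ?ndvd_neq0.
- move=> /zloc_predP[a [b [pb ->]]] /zloc_predP[c [d [pd ->]]].
  apply/zloc_predP; exists (a * c), (b * d); split; first exact: ndvdM.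
  by rewrite !rmorphM /= mulf_div.
Qed.

HB.instance Definition _ :=
  GRing.isSubringClosed.Build rat (zloc_pred p_pr) zloc_subring_closed.

Record zloc := Zloc { zloc_val : rat; _ : zloc_val \in zloc_pred p_pr }.

HB.instance Definition _ := [isSub for zloc_val].
HB.instance Definition _ := [Choice of zloc by <:].
HB.instance Definition _ := [SubChoice_isSubComNzRing of zloc by <:].

Definition principal (a : zloc) : set zloc := range (fun z => a * z).

(* [zloc_ord a] is the unique [r] with [a Z_p = p ^ r Z_p], for [a != 0]. *)
Definition zloc_ord (a : zloc) : nat :=
  xget 0%N [set r | principal a = principal (p%:R ^+ r)].

End Localization.

(** * The quotient by a product of three linear factors *)

(* [{poly %/ h}] is the quotient by [mk_monic h]; here this is [h] itself. *)
Lemma mk_monic_XXX (A : comNzRingType) (a b : A) :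
  mk_monic ('X * ('X - a%:P) * ('X - b%:P)) = 'X * ('X - a%:P) * ('X - b%:P).
Proof.
have h_mon : 'X * ('X - a%:P) * ('X - b%:P) \is monic.
  by rewrite !monicMl ?monicX ?monicXsubC.
by rewrite /mk_monic h_mon size_Mmonic ?monicXsubC ?monic_neq0 ?monicMl
  ?monicX ?monicXsubC // size_XsubC addn2 /= size_Mmonic ?monicXsubC
  ?monic_neq0 ?monicX // size_XsubC size_polyX.
Qed.

(** * Full ideals and the ideal zeta function *)

Section Zeta.
Variable R : comNzRingType.

(* Unlike the ideals of [ring_quotient], these need not be proper. *)
Definition is_ideal (I : set R) :=
  [/\ I 0, (forall a b, I a -> I b -> I (a + b))
    & forall r a, I a -> I (r * a)].

Definition cosets (I : set R) : set (set R) :=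
  range (fun r => [set r + a | a in I]).

Definition full_ideal (I : set R) := is_ideal I /\ finite_set (cosets I).

Definition ideal_index (I : set R) : nat := #|` fset_set (cosets I)|.

Definition ideals_of_index (m : nat) : set (set R) :=
  [set I | full_ideal I /\ ideal_index I = m].

(* The sum of [|R : I| ^- s] over the full ideals makes sense as a formal power
   series in [p ^- s] when all the indices are powers of [p] and each of them
   occurs finitely often. *)
Definition zeta_defined (p : nat) :=
  (forall I, full_ideal I -> exists n, ideal_index I = (p ^ n)%N) /\
  (forall n, finite_set (ideals_of_index (p ^ n))).

Definition zeta (p : nat) : {fps int} :=
  Fps (fun n => #|` fset_set (ideals_of_index (p ^ n))|%:R).

End Zeta.

(* Main.v *)
Require Import Defs.
From mathcomp Require Import all_boot all_order all_algebra.
From mathcomp Require Import finmap boolp classical_sets functions cardinality.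
From mathcomp Require Import zify ring.

(** As [alpha] and [beta] are units and [beta - alpha] is [p ^ k] times a unit,
    the map [f |-> (f(0), f(alpha), (f(beta) - f(alpha)) / p ^ k)] identifies [R]
    with [Z_p ^ 3], with product
    [(r, s, q) (r', s', q') = (r r', s s', s q' + q s' + p ^ k q q')].
    By Hermite reduction a full ideal has a unique basis
    [(p ^ m, 0, 0), (0, p ^ a, c), (0, 0, p ^ b)] with [c] an integer such that
    [0 <= c < p ^ b]; such a lattice has index [p ^ (m + a + b)], and it is an
    ideal exactly when [p ^ b] divides [p ^ a + c p ^ k].  For given [a] and [b]
    there are [p ^ min(b, k)] such [c] if [min(b, k) <= a], and none otherwise;
    summing over [m], [a] and [b], with [b < k] and [b >= k] apart, gives the two
    terms of the formula. *)

Set Implicit Arguments.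
Unset Strict Implicit.
Unset Printing Implicit Defensive.

Import Order.TTheory GRing.Theory Num.Theory.
Local Open Scope ring_scope.

(** * The localization at [p] *)

Section LocalizationTheory.
Variables (p : nat) (p_pr : prime p).
Local Notation Zp := (zloc p_pr).
Implicit Types (x y z : Zp) (n : nat).

(** [zloc] is declared only as a commutative ring, so cancellation is inherited from the field
    [rat]. *)
Lemma zloc_mulfI z : z != 0 -> injective (fun y => z * y).
Proof.
move=> z0 x y /(congr1 val); rewrite !rmorphM /= => /mulfI xy.
by apply/val_inj/xy; rewrite -[0]/(val (0 : Zp)) val_eqE.
Qed.

Lemma zloc_intr_eq0 (i : int) : (i%:~R == 0 :> Zp) = (i == 0).
Proof. by rewrite -val_eqE rmorph_int /= intr_eq0. Qed.

Lemma zloc_pX_neq0 n : p%:R ^+ n != 0 :> Zp.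
Proof.
rewrite -natrX -[(p ^ n)%:R]/((p ^ n)%:Z%:~R) zloc_intr_eq0.
by rewrite eqz_nat -lt0n expn_gt0 prime_gt0.
Qed.

Lemma zlocE z :
  exists a b : int, ~~ (p %| b)%Z /\ (b%:~R : Zp) * z = a%:~R.
Proof.
case: z => q qP; have /zloc_predP[a [b [pb qE]]] := qP; exists a, b; split=> //.
apply: val_inj; rewrite rmorphM !rmorph_int /= qE mulrC divfK //.
by rewrite intr_eq0; apply: contraNneq pb => ->; rewrite dvdz0.
Qed.

Lemma zloc_int_unit (b : int) : ~~ (p %| b)%Z -> exists y : Zp, b%:~R * y = 1.
Proof.
move=> pb; have qP : b%:Q^-1 \in zloc_pred p_pr.
  by apply/zloc_predP; exists 1, b; rewrite mul1r.
exists (Zloc qP); apply: val_inj; rewrite rmorphM rmorph1 rmorph_int /=.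
rewrite divff // intr_eq0.
by apply: contraNneq pb => ->; rewrite dvdz0.
Qed.

(** With [y = c / b] and [b] prime to [p], the equation reads [b a = p ^ n c] over the integers, and
    [b] is cancelled by coprimality. *)
Lemma zloc_dvd_int n (a : int) :
  (exists y : Zp, a%:~R = p%:R ^+ n * y) -> (p ^ n %| `|a|)%N.
Proof.
case=> y ay; have [c [b [pb yE]]] := zlocE y.
have : (b * a)%:~R = ((p ^ n)%N%:Z * c)%:~R :> Zp.
  by rewrite !rmorphM /= ay -yE -natrX; ring.
move/eqP; rewrite -subr_eq0 -rmorphB /= zloc_intr_eq0 subr_eq0 => /eqP ba.
have : (p ^ n %| absz (b * a)%R)%N by rewrite ba abszM dvdn_mulr.
by rewrite abszM Gauss_dvdr // coprimeXl // prime_coprime // -dvdzE.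
Qed.

Lemma zloc_dvd_nat n (a : nat) y : a%:R = p%:R ^+ n * y -> (p ^ n %| a)%N.
Proof. by move=> ay; apply: (@zloc_dvd_int n a%:Z); exists y. Qed.

Lemma zloc_residue_inj n (i j : nat) y : (i < p ^ n)%N -> (j < p ^ n)%N ->
  i%:R - j%:R = p%:R ^+ n * y -> i = j.
Proof.
move=> ilt jlt ij; have : (p ^ n %| absz (i%:Z - j%:Z)%R)%N.
  by apply: zloc_dvd_int; exists y; rewrite rmorphB.
wlog le_ji : i j {ij} ilt jlt / (j <= i)%N.
  by move=> H; case: (leqP j i) => [|/ltnW] le_ij; [|
    rewrite distnC => /(H _ _ jlt ilt le_ij)]; auto.
by rewrite distnEl // -eqn_mod_dvd // !modn_small // => /eqP.
Qed.

(** Write [z = a / b] with [b] prime to [p]. Multiplying [z] by a Bezout relation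
    [u b + v p ^ n = 1] shows that [z] and [u a] agree modulo [p ^ n]. *)
Lemma zloc_residue n z : exists i : nat, (i < p ^ n)%N /\
  exists y, z = i%:R + p%:R ^+ n * y.
Proof.
have [a [b [pb zE]]] := zlocE z; have [b' bb'] := zloc_int_unit pb.
have pn_gt0 : (0 < p ^ n)%N by rewrite expn_gt0 prime_gt0.
have cop : coprimez b (p ^ n)%N%:Z.
  by rewrite coprimezE absz_nat coprime_sym coprimeXl // prime_coprime // -dvdzE.
have [u [v uv]] := Bezoutz b (p ^ n)%N%:Z; rewrite (eqP cop) in uv.
exists `|(u * a %% (p ^ n)%N)%Z|%N; split.
  by rewrite -ltz_nat gez0_abs ?modz_ge0 ?ltz_pmod //; lia.
exists (b' * a%:~R * v%:~R + (u * a %/ (p ^ n)%N)%Z%:~R).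
have -> : z = b' * a%:~R by rewrite -zE mulrA [b' * _]mulrC bb' mul1r.
rewrite pmulrn gez0_abs ?modz_ge0 //; last lia.
set i : int := (_ %% _)%Z; set q : int := (_ %/ _)%Z.
have uaE : u%:~R * a%:~R = q%:~R * p%:R ^+ n + i%:~R :> Zp.
  by rewrite -natrX -rmorphM /= (divz_eq (u * a) (p ^ n)%N) rmorphD rmorphM.
have bez : u%:~R * b%:~R + v%:~R * p%:R ^+ n = 1 :> Zp.
  by rewrite -natrX -[_%:R]/((p ^ n)%N%:~R) -!rmorphM -rmorphD /= uv.
rewrite -[LHS]mulr1 -[X in _ * X = _]bez.
transitivity (b%:~R * b' * (u%:~R * a%:~R) + p%:R ^+ n * (b' * a%:~R * v%:~R)).
  by ring.
by rewrite bb' uaE; ring.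
Qed.

Lemma zloc_divisible_or_unit z :
  (exists y, z = p%:R * y) \/ (exists y, z * y = 1).
Proof.
have [i [i_lt [y zE]]] := zloc_residue 1 z.
have [i0|i_gt0] := posnP i.
  by left; exists y; rewrite zE i0 add0r expr1.
right; have [a [b [pb bz]]] := zlocE z; have [b' bb'] := zloc_int_unit pb.
have pa : ~~ (p %| a)%Z.
  apply/negP=> /dvdzP[c ac].
  have : (p ^ 1 %| i)%N.
    apply: (@zloc_dvd_nat 1 i (b' * c%:~R - y)).
    have -> : i%:R = z - p%:R ^+ 1 * y by rewrite zE addrK.
    have -> : z = b' * (b%:~R * z) by rewrite mulrA [b' * _]mulrC bb' mul1r.
    by rewrite bz ac rmorphM /=; ring.
  by rewrite expn1 gtnNdvd // -{2}(expn1 p).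
have [a' aa'] := zloc_int_unit pa; exists (a' * b%:~R).
by rewrite mulrCA [z * _]mulrC bz mulrC.
Qed.

Lemma zloc_factor z : z != 0 ->
  exists r u v, z = p%:R ^+ r * u /\ u * v = 1.
Proof.
have [a [b [pb bz]]] := zlocE z; have [b' bb'] := zloc_int_unit pb => z0.
have zE : z = b' * a%:~R by rewrite -bz mulrA [b' * _]mulrC bb' mul1r.
have a_gt0 : (0 < `|a|)%N.
  by rewrite absz_gt0; apply: contra_neq z0 => a0; rewrite zE a0 mulr0.
set r := logn p `|a|; have [c ac] : exists c, a = c * (p ^ r)%N%:Z.
  by apply/dvdzP; rewrite dvdzE absz_nat pfactor_dvdnn.
have pc : ~~ (p %| c)%Z.
  apply/negP=> /dvdzP[d cd]; have : (p ^ r.+1 %| `|a|)%N.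
    by rewrite ac cd !abszM !absz_nat -mulnA -expnS dvdn_mull.
  by rewrite pfactor_dvdn // ltnn.
have [c' cc'] := zloc_int_unit pc; exists r, (b' * c%:~R), (b%:~R * c'); split.
  by rewrite zE ac rmorphM /= -natrX -[_%:R]/((p ^ r)%N%:~R); ring.
by rewrite mulrACA [b' * _]mulrC bb' cc' mulr1.
Qed.

Lemma zloc_ord_factor z : z != 0 ->
  exists u v, z = p%:R ^+ zloc_ord z * u /\ u * v = 1.
Proof.
move=> z0; suff [[u zE] [v pE]] :
    (exists u, z = p%:R ^+ zloc_ord z * u) /\ exists v, p%:R ^+ zloc_ord z = z * v.
  exists u, v; split=> //; apply: (zloc_mulfI (zloc_pX_neq0 (zloc_ord z))).
  by rewrite mulr1 mulrA -zE -pE.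
(* [zloc_ord] is an [xget] with default 0; [zloc_factor] shows that its defining set is inhabited,
   so the default is not what is returned. *)
have : principal z = principal (p%:R ^+ zloc_ord z).
  apply: (@xgetPex _ 0%N [set r | principal z = principal (p%:R ^+ r)]).
  have [r [u [v [zE uv]]]] := zloc_factor z0; exists r.
  apply/seteqP; split=> _ [y _ <-].
    by exists (u * y); rewrite // mulrA -zE.
  by exists (v * y); rewrite // zE -mulrA (mulrA u) uv mul1r.
move=> zp; split.
  have [u _ uE] : principal (p%:R ^+ zloc_ord z) z; last by exists u.
  by rewrite -zp; exists 1; rewrite ?mulr1.
have [v _ vE] : principal z (p%:R ^+ zloc_ord z); last by exists v.
by rewrite zp; exists 1; rewrite ?mulr1.
Qed.

(** Take [m] least with [p ^ m] in [J]. If [z] in [J] equals [p ^ j y] with [j < m], then [y] is not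
    a unit, as otherwise [p ^ j] would lie in [J]; so another factor [p] comes out. *)
Lemma zloc_ideal (J : set Zp) N : J (p%:R ^+ N) ->
  (forall y z, J z -> J (y * z)) ->
  exists m, forall z, J z <-> exists y, z = p%:R ^+ m * y.
Proof.
move=> JN JM; have exJ : exists n, `[< J (p%:R ^+ n) >] by exists N; apply/asboolP.
case: (ex_minnP exJ) => m /asboolP Jm minm; exists m => z; split; last first.
  by move=> [y ->]; rewrite mulrC; apply: JM.
move=> Jz; suff: forall j, (j <= m)%N -> exists y, z = p%:R ^+ j * y by apply.
elim=> [|j IH] jm; first by exists z; rewrite mul1r.
have [y zE] := IH (ltnW jm).
have [[y' yE]|[y' yy']] := zloc_divisible_or_unit y.
  by exists y'; rewrite zE yE mulrA exprSr.
have /asboolP/minm : J (p%:R ^+ j); last by rewrite leqNgt jm.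
by rewrite -[_ ^+ _]mulr1 -[X in _ * X]yy' mulrA -zE mulrC; apply: JM.
Qed.

End LocalizationTheory.

(** * Ideals with a triangular basis *)

(** Turns a classical cardinality into one over a finite type; it serves both for the cosets of an
    ideal and for the ideals of a given index. *)
Lemma card_fset_set_image (T : finType) (U : choiceType) (A : {pred T})
    (f : T -> U) (S : set U) : {in A &, injective f} ->
  S = [set f x | x in [set x | x \in A]]%classic ->
  finite_set S /\ #|` fset_set S| = #|A|.
Proof.
move=> finj ->; split; first exact/finite_image/finite_finset.
have -> : fset_set [set f x | x in [set x | x \in A]]%classic = [fset f x | x in A]%fset.
  apply/fsetP=> y; rewrite in_fset_set; last exact/finite_image/finite_finset.
  apply/idP/imfsetP => [|[x /= xA ->]]; rewrite inE.
    by case=> x xA <-; exists x.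
  by exists x.
by rewrite card_in_imfset //= -cardE.
Qed.

Lemma coset_eqP (R : comNzRingType) (I : set R) x y : is_ideal I ->
  [set x + z | z in I]%classic = [set y + z | z in I]%classic <-> I (x - y).
Proof.
case=> I0 ID IM; split.
  move=> xy; have : [set x + z | z in I]%classic x by exists 0; rewrite ?addr0.
  by rewrite xy => -[z Iz <-]; rewrite addrC addKr.
move=> Ixy; apply/seteqP; split=> _ [z Iz <-].
  by exists (x - y + z); [apply: ID | rewrite addrA (addrC y) subrK].
have Iyx : I (y - x) by rewrite -opprB -mulN1r; apply: IM.
by exists (y - x + z); [apply: ID | rewrite addrA (addrC x) subrK].
Qed.

(** * Counting the off-diagonal entries [c] *)

Section TriangularCount.
Variables p k : nat.

(** The divisibility expresses that [(0, p ^ a, c) (0, 0, 1) = (0, 0, p ^ a + c p ^ k)] stays in the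
    lattice. *)
Definition tri_valid a b c := (c < p ^ b)%N && (p ^ b %| p ^ a + c * p ^ k)%N.

Definition tri_count a b := (if minn b k <= a then p ^ minn b k else 0)%N.

(** The multiples of [M] among [q M] consecutive positive integers are counted as a difference of
    two floor quotients. *)
Lemma sum_dvdn_shift M d q : (0 < M)%N -> (0 < d)%N ->
  (\sum_(0 <= c < q * M) (M %| d + c) = q)%N.
Proof.
case: d => // d M_gt0 _.
have /eqP := divnMDl q d M_gt0; rewrite !divn_count_dvd.
rewrite (@big_cat_nat _ _ _ d.+1) //=; last by rewrite ltnS leq_addl.
rewrite addnC eqn_add2r => /eqP qE; rewrite -[RHS]qE.
rewrite -[d.+1 in RHS]add0n big_addn -addnS addnK.
by apply: eq_bigr => c _; rewrite addnC.
Qed.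

(** The ambient type ['I_(p ^ n)] does not depend on [b], so that the counts for all [b <= n] can
    later be taken inside one finite type. *)
Lemma card_tri_valid n a b : prime p -> (b <= n)%N ->
  #|[pred c : 'I_(p ^ n) | tri_valid a b c]| = tri_count a b.
Proof.
move=> p_pr le_bn.
have p_gt0 := prime_gt0 p_pr; have p_gt1 := prime_gt1 p_pr.
transitivity (\sum_(0 <= c < p ^ b) (p ^ b %| p ^ a + c * p ^ k))%N.
  rewrite (big_nat_widen _ _ (p ^ n)%N) ?leq_pexp2l // big_mkord.
  rewrite -sum1_card big_mkcond [RHS]big_mkcond; apply: eq_bigr => c _.
  by rewrite !inE /tri_valid; case: (c < _)%N => //=; case: (_ %| _)%N.
rewrite /tri_count; case: leqP => [le_a|lt_a]; last first.
  (* Here [p ^ a.+1] divides both [p ^ b] and [p ^ k], so a valid [c] would make it divide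
     [p ^ a]. *)
  rewrite big1 // => c _; apply/eqP; rewrite eqb0; apply/negP => dvd.
  have : (p ^ a.+1 %| p ^ a + c * p ^ k)%N.
    by apply: dvdn_trans dvd; rewrite dvdn_Pexp2l // (leq_trans lt_a) ?geq_minl.
  rewrite dvdn_addl; last first.
    by rewrite dvdn_mull // dvdn_Pexp2l // (leq_trans lt_a) ?geq_minr.
  by rewrite dvdn_Pexp2l // ltnn.
case: (leqP b k) le_a => [le_bk le_ba|/ltnW le_kb le_ka].
  rewrite (eq_bigr (fun=> 1%N)) => [|c _].
    by rewrite sum_nat_const_nat subn0 muln1.
  by rewrite dvdn_add ?dvdn_mull // dvdn_Pexp2l.
(* Dividing by [p ^ k] leaves [p ^ (b - k) %| p ^ (a - k) + c], where [c] runs through [p ^ k] full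
   periods. *)
rewrite -{1}(subnKC le_kb) expnD.
rewrite -[RHS](@sum_dvdn_shift (p ^ (b - k)) (p ^ (a - k))) ?expn_gt0 ?p_gt0 //.
apply: eq_bigr => c _; congr nat_of_bool.
have -> : (p ^ b = p ^ k * p ^ (b - k))%N by rewrite -expnD subnKC.
have -> : (p ^ a = p ^ k * p ^ (a - k))%N by rewrite -expnD subnKC.
rewrite [(c * _)%N]mulnC -mulnDr.
by rewrite dvdn_pmul2l // expn_gt0 p_gt0.
Qed.

End TriangularCount.

(** * Full ideals of a ring with coordinates [(r, s, q)] *)

Section TriangularIdeals.
Variables (p : nat) (p_pr : prime p) (k : nat) (R : comNzRingType).
Local Notation Zp := (zloc p_pr).
Local Notation P n := (p%:R ^+ n : Zp).
Variable elt : Zp -> Zp -> Zp -> R.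
Hypothesis elt_surj : forall x, exists r s q, x = elt r s q.
Hypothesis elt_inj : forall r s q r' s' q',
  elt r s q = elt r' s' q' -> [/\ r = r', s = s' & q = q'].
Hypothesis eltD : forall r s q r' s' q',
  elt r s q + elt r' s' q' = elt (r + r') (s + s') (q + q').
Hypothesis eltM : forall r s q r' s' q',
  elt r s q * elt r' s' q' =
  elt (r * r') (s * s') (s * q' + q * s' + P k * q * q').

Lemma elt0 : elt 0 0 0 = 0.
Proof. by apply: (@addrI _ (elt 0 0 0)); rewrite eltD !addr0. Qed.

Lemma eltB r s q r' s' q' :
  elt r s q - elt r' s' q' = elt (r - r') (s - s') (q - q').
Proof.
apply: (@addIr _ (elt r' s' q')); rewrite subrK eltD; congr elt; ring.
Qed.

Definition tri_ideal m a b c : set R := [set x | exists r s q,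
  x = elt (P m * r) (P a * s) (c%:R * s + P b * q)]%classic.

Lemma tri_idealP m a b c r s q : tri_ideal m a b c (elt r s q) <->
  [/\ exists r', r = P m * r' &
      exists s' q', s = P a * s' /\ q = c%:R * s' + P b * q'].
Proof.
split=> [[r' [s' [q' /elt_inj[-> -> ->]]]] | [[r' ->] [s' [q' [-> ->]]]]].
  by split; [exists r' | exists s', q'].
by exists r', s', q'.
Qed.

Lemma tri_ideal_is_ideal m a b c :
  (p ^ b %| p ^ a + c * p ^ k)%N -> is_ideal (tri_ideal m a b c).
Proof.
case/dvdnP=> d dE; have {}dE : P a + c%:R * P k = d%:R * P b.
  by rewrite -!natrX -!natrM -natrD dE.
split=> [|_ _ [r [s [q ->]]] [r' [s' [q' ->]]]|x _ [r [s [q ->]]]].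
- by exists 0, 0, 0; rewrite !mulr0 addr0 elt0.
- by exists (r + r'), (s + s'), (q + q'); rewrite eltD; congr elt; ring.
have [R' [S [Q ->]]] := elt_surj x; rewrite eltM.
(* The third coordinate of the product contains [Q s (p ^ a + c p ^ k)], which is [Q s d p ^ b];
   this gives the term [Q * s * d%:R]. *)
exists (R' * r), (S * s), (S * q + Q * s * d%:R + P k * Q * q).
congr elt; first ring; first ring.
transitivity (c%:R * (S * s) + P b * (S * q + P k * Q * q)
  + Q * s * (P a + c%:R * P k)); first by ring.
by rewrite dE; ring.
Qed.

(* By pigeonhole [p ^ i] and [p ^ j] agree modulo [I] for some [i < j], and
   [1 - p ^ (j - i)] is a unit. *)
Lemma full_ideal_pX I : full_ideal I -> exists N, I (elt (P N) (P N) 0).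
Proof.
move=> [Iid Ifin]; have [_ _ IM] := Iid.
pose f n := [set elt (P n) (P n) 0 + z | z in I]%classic.
have [i [j [ij fij]]] : exists i j, (i < j)%N /\ f i = f j.
  apply: contrapT => noij; apply: infinite_nat.
  have -> : [set: nat]%classic = (f @^-1` cosets I)%classic.
    by apply/seteqP; split=> // n _; exists (elt (P n) (P n) 0).
  apply: finite_preimage Ifin => i j _ _ fij; apply: contrapT => /eqP.
  by rewrite neq_ltn => /orP[] lt_ij; apply: noij; [exists i, j | exists j, i].
have /(coset_eqP _ _ Iid) := fij; rewrite eltB => Iij.
have [y yE] : exists y : Zp, (1 - p%:Z ^+ (j - i))%:~R * y = 1.
  apply: zloc_int_unit; rewrite -(subnSK ij) exprS; apply/negP=> pd.
  have : (p%:Z %| 1 - p%:Z * p%:Z ^+ (j - i.+1) + p%:Z * p%:Z ^+ (j - i.+1))%Z.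
    by rewrite rpredD // dvdz_mulr.
  by rewrite subrK dvdzE dvdn1 gtn_eqF ?prime_gt1.
exists i; have := IM (elt y y 0) _ Iij; rewrite eltM.
have -> : y * (P i - P j) = P i.
  rewrite rmorphB rmorph1 rmorphXn /= -pmulrn in yE.
  have -> : P j = P i * P (j - i) by rewrite -exprD subnKC // ltnW.
  transitivity (P i * ((1 - P (j - i)) * y)); first by ring.
  by rewrite yE mulr1.
by rewrite subrr !(mulr0, mul0r, addr0).
Qed.

(** The exponents [m], [a], [b] generate three ideals of [Zp]: the [r] with [(r, 0, 0)] in [I], the
    [s] with some [(0, s, q)] in [I], and the [q] with [(0, 0, q)] in [I]. Each contains [p ^ N] by
    [full_ideal_pX]. *)
Lemma full_ideal_tri I : full_ideal I ->
  exists m a b c, tri_valid p k a b c /\ I = tri_ideal m a b c.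
Proof.
move=> Ifull; have [N IN] := full_ideal_pX Ifull.
have [[I0 ID IM] _] := Ifull.
have IB x y : I x -> I y -> I (x - y).
  by move=> Ix Iy; apply: ID => //; rewrite -mulN1r; apply: IM.
(* Multiplication by the idempotents [elt 1 0 0] and [elt 0 1 0] keeps [r], respectively [(s, q)],
   and kills the rest; [elt y y 0] acts as the scalar [y]. *)
have [|y r Ir|m mP] := @zloc_ideal _ _ [set r | I (elt r 0 0)]%classic N.
- by move/(IM (elt 1 0 0)): IN; rewrite eltM !(mul1r, mulr0, mul0r, addr0).
- by move/(IM (elt y 0 0)): Ir; rewrite eltM !(mul1r, mulr0, mul0r, addr0).
have [|y s [q Is]|a aP] :=
  @zloc_ideal _ _ [set s | exists q, I (elt 0 s q)]%classic N.
- exists 0; move/(IM (elt 0 1 0)): IN.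
  by rewrite eltM !(mul1r, mulr0, mul0r, addr0).
- exists (y * q); move/(IM (elt 0 y 0)): Is.
  by rewrite eltM !(mul1r, mulr0, mul0r, addr0).
have [|y q Iq|b bP] := @zloc_ideal _ _ [set q | I (elt 0 0 q)]%classic N.
- by move/(IM (elt 0 0 1)): IN; rewrite eltM !(mul1r, mulr0, mul0r, addr0, add0r).
- by move/(IM (elt y y 0)): Iq; rewrite eltM !(mul1r, mulr0, mul0r, addr0).
have [c0 Ic0] : exists q, I (elt 0 (P a) q).
  by apply/(aP (P a)); exists 1; rewrite mulr1.
(* Subtracting a multiple of [(0, 0, p ^ b)] replaces [c0] by its residue modulo [p ^ b]. *)
have [c [c_lt [y c0E]]] := zloc_residue b c0.
have Ib q : I (elt 0 0 (P b * q)) by apply/bP; exists q.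
have Ic : I (elt 0 (P a) c%:R).
  by have := IB _ _ Ic0 (Ib y); rewrite eltB c0E addrK !subr0.
exists m, a, b, c; split.
  rewrite /tri_valid c_lt /=.
  have /bP[d dE] : I (elt 0 0 (P a + c%:R * P k)).
    have := IM (elt 0 0 1) _ Ic; rewrite eltM.
    by rewrite !(mul1r, mulr1, mul0r, add0r) (mulrC (P k)).
  by apply: (@zloc_dvd_nat _ p_pr b _ d); rewrite -dE natrD natrM !natrX.
apply/seteqP; split=> [x Ix|_ [r [s [q ->]]]]; last first.
  have -> : elt (P m * r) (P a * s) (c%:R * s + P b * q) =
      elt (P m * r) 0 0 + elt s s 0 * elt 0 (P a) c%:R + elt 0 0 (P b * q).
    by rewrite eltM !eltD; congr elt; ring.
  apply: (ID _ _ _ (Ib q)); apply: (ID _ _ _ (IM _ _ Ic)).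
  by apply/mP; exists r.
have [r [s [q xE]]] := elt_surj x; rewrite xE in Ix *.
have /mP[r' ->] : I (elt r 0 0).
  by have := IM (elt 1 0 0) _ Ix; rewrite eltM !(mul1r, mulr0, mul0r, addr0).
have Isq : I (elt 0 s q).
  by have := IM (elt 0 1 0) _ Ix; rewrite eltM !(mul1r, mulr0, mul0r, addr0).
have /aP[s' sE] : exists q, I (elt 0 s q) by exists q.
have /bP[q' qE] : I (elt 0 0 (q - c%:R * s')).
  have -> : elt 0 0 (q - c%:R * s') = elt 0 s q - elt s' s' 0 * elt 0 (P a) c%:R.
    by rewrite eltM eltB sE; congr elt; ring.
  exact: IB Isq (IM _ _ Ic).
by exists r', s', q'; rewrite -sE -qE subrKC.
Qed.

Lemma zloc_pX_dvd m n (y : Zp) : P m = P n * y -> (n <= m)%N.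
Proof.
move=> mn; have : (p ^ n %| p ^ m)%N.
  by apply: (@zloc_dvd_nat _ p_pr n _ y); rewrite natrX.
by rewrite dvdn_Pexp2l ?prime_gt1.
Qed.

(** Each of the three basis vectors of the smaller lattice is expanded in the basis of the larger
    one. If [a = a'], the second expansion has leading coefficient 1, whence [c] and [c'] agree
    modulo [p ^ b']. *)
Lemma tri_ideal_le m a b c m' a' b' c' :
    (tri_ideal m a b c `<=` tri_ideal m' a' b' c')%classic ->
  [/\ (m' <= m)%N, (a' <= a)%N, (b' <= b)%N &
     a = a' -> b = b' -> (c < p ^ b)%N -> (c' < p ^ b')%N -> c = c'].
Proof.
move=> sub; have eltI r s q :
    tri_ideal m' a' b' c' (elt (P m * r) (P a * s) (c%:R * s + P b * q)).
  by apply: sub; exists r, s, q.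
have /tri_idealP[[r rE] _] := eltI 1 0 0.
have /tri_idealP[_ [s [q [sE qE]]]] := eltI 0 1 0.
have /tri_idealP[_ [s' [q' [s'E q'E]]]] := eltI 0 0 1.
move: rE sE qE s'E q'E; rewrite !mulr1 !mulr0 addr0 add0r => rE sE qE.
rewrite -{1}(mulr0 (P a')) => /(zloc_mulfI (zloc_pX_neq0 _ _)) <-.
rewrite mulr0 add0r => q'E; split; [exact: zloc_pX_dvd rE | | |].
- exact: zloc_pX_dvd sE.
- exact: zloc_pX_dvd q'E.
move=> aa' bb' c_lt c'_lt; rewrite -aa' -{1}[P a]mulr1 in sE.
rewrite -(zloc_mulfI (zloc_pX_neq0 _ _) sE) mulr1 in qE.
rewrite bb' in c_lt; apply: (zloc_residue_inj (p_pr := p_pr) c_lt c'_lt (y := q)).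
by rewrite qE addrC addKr.
Qed.

Lemma tri_ideal_inj m a b c m' a' b' c' :
    (c < p ^ b)%N -> (c' < p ^ b')%N ->
    tri_ideal m a b c = tri_ideal m' a' b' c' ->
  [/\ m = m', a = a', b = b' & c = c'].
Proof.
move=> c_lt c'_lt eqI.
have /tri_ideal_le[m'm a'a b'b cc'] :
  (tri_ideal m a b c `<=` tri_ideal m' a' b' c')%classic by rewrite eqI.
have /tri_ideal_le[mm' aa' bb' _] :
  (tri_ideal m' a' b' c' `<=` tri_ideal m a b c)%classic by rewrite eqI.
have [? ? ?] : [/\ m = m', a = a' & b = b'] by split; apply/anti_leq/andP.
by split=> //; apply: cc'.
Qed.

Lemma tri_ideal_full m a b c : (p ^ b %| p ^ a + c * p ^ k)%N ->
  full_ideal (tri_ideal m a b c) /\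
  ideal_index (tri_ideal m a b c) = (p ^ (m + a + b))%N.
Proof.
move=> dvd; have Iid := tri_ideal_is_ideal m dvd.
pose T := ('I_(p ^ m) * 'I_(p ^ a) * 'I_(p ^ b))%type.
pose f (t : T) := [set elt t.1.1%:R t.1.2%:R t.2%:R + z
  | z in tri_ideal m a b c]%classic.
have [fin card] : finite_set (cosets (tri_ideal m a b c)) /\
    #|` fset_set (cosets (tri_ideal m a b c))| = #|{: T}|.
  apply: (@card_fset_set_image _ _ _ f).
    move=> [[i j] l] [[i' j'] l'] _ _ /(coset_eqP _ _ Iid) /=; rewrite eltB.
    case/tri_idealP=> -[r rE] [s [q [sE qE]]].
    have ii' := zloc_residue_inj (ltn_ord i) (ltn_ord i') rE.
    have jj' := zloc_residue_inj (ltn_ord j) (ltn_ord j') sE.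
    move: sE; rewrite jj' subrr -(mulr0 (P a)).
    move/(zloc_mulfI (zloc_pX_neq0 _ _)) => s0.
    rewrite -s0 mulr0 add0r in qE.
    have ll' := zloc_residue_inj (ltn_ord l) (ltn_ord l') qE.
    by congr (_, _, _); apply: val_inj.
  apply/seteqP; split=> [_ [x _ <-]|_ [t _ <-]]; last first.
    by exists (elt t.1.1%:R t.1.2%:R t.2%:R).
  have [r [s [q ->]]] := elt_surj x.
  have [i [i_lt [r' rE]]] := zloc_residue m r.
  have [j [j_lt [s' sE]]] := zloc_residue a s.
  (* Removing [s'] times the vector [(0, p ^ a, c)] also changes the third coordinate, so [q] is
     corrected by [c s'] before reduction. *)
  have [l [l_lt [q' qE]]] := zloc_residue b (q - c%:R * s').
  exists (Ordinal i_lt, Ordinal j_lt, Ordinal l_lt) => //=.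
  apply/(coset_eqP _ _ Iid); rewrite eltB; apply/tri_idealP; split.
    by exists (- r'); rewrite rE; ring.
  exists (- s'), (- q'); rewrite sE; split; first ring.
  by rewrite -[q](subrK (c%:R * s')) qE; ring.
by split=> //; rewrite /ideal_index card !card_prod !card_ord !expnD.
Qed.

Lemma ideals_of_index_tri n :
  finite_set (@ideals_of_index R (p ^ n)) /\
  #|` fset_set (@ideals_of_index R (p ^ n))| =
    (\sum_(i < n.+1) \sum_(b < i.+1) tri_count p k (i - b) b)%N.
Proof.
(* A triple [(i, b, c)] encodes [i = a + b]; index [p ^ n] forces [m = n - i]. Summing over [i] last
   will become a factor [1 / (1 - x)]. *)
pose T := ('I_n.+1 * 'I_n.+1 * 'I_(p ^ n))%type.
pose A := [pred t : T |
  (t.1.2 <= t.1.1)%N && tri_valid p k (t.1.1 - t.1.2) t.1.2 t.2].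
pose f (t : T) := tri_ideal (n - t.1.1) (t.1.1 - t.1.2) t.1.2 t.2.
have p_gt1 := prime_gt1 p_pr.
have [fin ->] : finite_set (@ideals_of_index R (p ^ n)) /\
    #|` fset_set (@ideals_of_index R (p ^ n))| = #|A|.
  apply: (@card_fset_set_image _ _ _ f).
    move=> [[i b] c] [[i' b'] c']; rewrite !inE /=.
    case/andP=> le_bi /andP[c_lt _] /andP[le_bi' /andP[c'_lt _]].
    case/(tri_ideal_inj c_lt c'_lt) => _ eq_a eq_b eq_c.
    congr (_, _, _); apply: val_inj => //=.
    by rewrite -(subnK le_bi) eq_a eq_b subnK.
  apply/seteqP; split=> [I [Ifull Iidx]|_ [[[i b] c] /= tA <-]]; last first.
    move: tA; rewrite inE /= => /andP[le_bi /andP[_ dvd]].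
    have [full idx] := tri_ideal_full (n - i) dvd.
    by split; rewrite // idx -addnA subnK // subnK // -ltnS.
  have [m [a [b [c [abc IE]]]]] := full_ideal_tri Ifull.
  have /andP[c_lt dvd] := abc.
  have [_] := tri_ideal_full m dvd; rewrite -IE Iidx => /eqP.
  rewrite eqn_exp2l // => /eqP nE.
  have i_lt : (a + b < n.+1)%N by rewrite ltnS nE -addnA leq_addl.
  have b_lt : (b < n.+1)%N by rewrite ltnS nE leq_addl.
  have c_lt' : (c < p ^ n)%N by rewrite (leq_trans c_lt) // leq_pexp2l ?prime_gt0.
  exists (Ordinal i_lt, Ordinal b_lt, Ordinal c_lt') => /=.
    by rewrite inE /= leq_addl addnK.
  by rewrite IE /f /= addnK nE -addnA addnK.
split=> //; rewrite -sum1_card big_mkcond /=.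
rewrite -(pair_bigA _ (fun ib c => if (ib, c) \in A then 1 else 0)%N) /=.
rewrite -(pair_bigA _ (fun i b => \sum_c if (i, b, c) \in A then 1 else 0)%N) /=.
apply: eq_bigr => i _.
rewrite (big_ord_widen _ (fun b => tri_count p k (i - b) b) (ltn_ord i)).
rewrite [RHS]big_mkcond /=.
apply: eq_bigr => b _; rewrite ltnS; case: (leqP b i) => le_bi; last first.
  by rewrite big1 // => c _; rewrite inE /= leqNgt le_bi.
rewrite -(card_tri_valid k (i - b) p_pr (leq_trans le_bi (ltn_ord i) : b <= n)%N).
rewrite -sum1_card [RHS]big_mkcond; apply: eq_bigr => c _.
by rewrite !inE /= le_bi.
Qed.

Lemma zeta_defined_tri : zeta_defined R p.
Proof.
split=> [I Ifull|n]; last by case: (ideals_of_index_tri n).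
have [m [a [b [c [/andP[_ dvd] ->]]]]] := full_ideal_tri Ifull.
by exists (m + a + b)%N; case: (tri_ideal_full m dvd).
Qed.

End TriangularIdeals.

(** * Power series *)

Section FpsCoef.
Variable A : comNzRingType.
Implicit Types f g : {fps A}.

Lemma fps_coef_sum I (r : seq I) (F : I -> {fps A}) n :
  fps_coef (\sum_(i <- r) F i) n = \sum_(i <- r) fps_coef (F i) n.
Proof. exact: (big_morph (fun f => fps_coef f n)). Qed.

Lemma fps_coef_natl m f n : fps_coef (m%:R * f) n = m%:R * fps_coef f n.
Proof.
rewrite !mulr_natl; elim: m => [|m IH]; first by rewrite !mulr0n.
by rewrite !mulrS -IH.
Qed.

Lemma fps_coef_XM f n :
  fps_coef (fpsX A * f) n = if n is m.+1 then fps_coef f m else 0.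
Proof.
rewrite [LHS]/=; case: n => [|n]; first by rewrite big_ord1 mul0r.
rewrite 2!big_ord_recl /= mul0r add0r mul1r subSS subn0 big1 ?addr0 // => i _.
by rewrite mul0r.
Qed.

Lemma fps_coef_XnM m f n :
  fps_coef (fpsX A ^+ m * f) n = if (m <= n)%N then fps_coef f (n - m) else 0.
Proof.
elim: m n => [|m IH] n; first by rewrite mul1r subn0.
by rewrite exprS -mulrA fps_coef_XM; case: n => // n; rewrite IH.
Qed.

(** The expansion of [1 / (1 - X)]; multiplying by it takes partial sums. *)
Definition fps_geom : {fps A} := Fps (fun=> 1).

Lemma fps_coef_geomM f n : fps_coef (fps_geom * f) n = \sum_(i < n.+1) fps_coef f i.
Proof.
rewrite mulrC [LHS]/=; by apply: eq_bigr => i _; rewrite mulr1.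
Qed.

Lemma fps_geomV : (1 - fpsX A) * fps_geom = 1.
Proof.
rewrite mulrBl mul1r; apply: fpsP => n.
rewrite -[LHS]/(1 - fps_coef (fpsX A * fps_geom) n) fps_coef_XM.
by case: n => [|n] /=; rewrite ?subr0 ?subrr.
Qed.

End FpsCoef.

(** * Generating series of the counts *)

Section TriangularSeries.
Variables p k : nat.

(** With [a = n - b], the condition [minn b k <= a] reads [2 b <= n] for [b < k] and [k + b <= n]
    for [b >= k]. The latter admits [n + 1 - 2 k] values of [b], or none when the truncated
    difference is 0. *)
Lemma tri_count_sum n :
  (\sum_(b < n.+1) tri_count p k (n - b) b =
   \sum_(b < k) (2 * b <= n) * p ^ b + p ^ k * (n.+1 - 2 * k))%N.
Proof.
pose F b := (if b < k then (2 * b <= n) * p ^ b else (k + b <= n) * p ^ k)%N.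
transitivity (\sum_(0 <= b < n.+1) F b)%N.
  rewrite big_mkord; apply: eq_bigr => b _; rewrite /F /tri_count.
  have le_bn : (b <= n)%N by rewrite -ltnS.
  case: ltnP => [lt_bk|le_kb].
    have -> : (b <= n - b)%N = (2 * b <= n)%N by lia.
    by case: leqP; rewrite ?mul1n.
  have -> : (k <= n - b)%N = (k + b <= n)%N by lia.
  by case: leqP; rewrite ?mul1n.
have Fbig m : (n < m)%N -> F m = 0%N.
  move=> lt_nm; rewrite /F; case: ltnP => _.
    by have -> : (2 * m <= n)%N = false by lia.
  by have -> : (k + m <= n)%N = false by lia.
(* [F] vanishes beyond [n]; the longer range can be cut at [k] even if [k] exceeds [n.+1]. *)
transitivity (\sum_(0 <= b < n.+1 + k) F b)%N.
  rewrite [RHS](@big_cat_nat _ _ _ n.+1) ?leq_addr //=.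
  rewrite [\sum_(n.+1 <= _ < _) _]big_nat.
  by rewrite [X in (_ + X)%N]big1 ?addn0 // => m /andP[/Fbig].
rewrite (@big_cat_nat _ _ _ k) ?leq_addl //=; congr (_ + _)%N.
  by rewrite big_mkord; apply: eq_bigr => b _; rewrite /F ltn_ord.
rewrite -[X in (\sum_(X <= _ < _) _)%N]add0n big_addn addnK.
transitivity (\sum_(0 <= b < n.+1 | b < n.+1 - 2 * k) p ^ k)%N.
  rewrite [RHS]big_mkcond; apply: eq_bigr => b _; rewrite /F ltnNge leq_addl /=.
  have -> : (b < n.+1 - 2 * k)%N = (k + (b + k) <= n)%N by lia.
  by case: leqP; rewrite ?mul1n.
by rewrite -(big_nat_widen 0 _ _ predT) ?leq_subr // sum_nat_const_nat subn0 mulnC.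
Qed.

(** The term [p ^ b] for [2 b <= n] is the coefficient of [(p x ^ 2) ^ b / (1 - x)], and the
    truncated [n + 1 - 2 k] is that of [x ^ (2 k) / (1 - x) ^ 2]. *)
Lemma fps_tri_count :
  Fps (fun n => (\sum_(b < n.+1) tri_count p k (n - b) b)%:R) =
  (\sum_(b < k) (p%:R * fpsX int ^+ 2) ^+ b) * fps_geom int
  + p%:R ^+ k * fpsX int ^+ (2 * k) * fps_geom int ^+ 2.
Proof.
apply: fpsP => n; rewrite [LHS]/= tri_count_sum natrD natr_sum.
rewrite -[RHS]/(fps_coef (_ * _) n + fps_coef (_ * _) n); congr (_ + _).
  rewrite mulr_suml fps_coef_sum; apply: eq_bigr => b _.
  rewrite exprMn -exprM -mulrA -natrX fps_coef_natl fps_coef_XnM natrM mulrC.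
  by case: leqP.
rewrite -mulrA -natrX fps_coef_natl fps_coef_XnM natrM expr2; congr (_ * _).
rewrite fps_coef_geomM sumr_const card_ord.
case: leqP => [le_kn|]; first by rewrite subSn.
by rewrite -subn_eq0 => /eqP ->.
Qed.

Lemma tri_series :
  Fps (fun n => (\sum_(i < n.+1) \sum_(b < i.+1) tri_count p k (i - b) b)%:R) =
  (1 - p%:R ^+ k * fpsX int ^+ (2 * k)) / (1 - p%:R * fpsX int ^+ 2)
    * (1 / (1 - fpsX int) ^+ 2)
  + p%:R ^+ k * fpsX int ^+ (2 * k) / (1 - fpsX int) ^+ 3.
Proof.
(* Both denominators have constant coefficient 1, so the quotients are genuine. *)
set x := fpsX int; have xU : 1 - x \is a GRing.unit.
  by apply: unit_fps; rewrite -[fps_coef _ _]/(1 - 0) subr0 unitr1.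
have pxU : 1 - p%:R * x ^+ 2 \is a GRing.unit.
  apply: unit_fps; rewrite -[fps_coef _ _]/(1 - fps_coef (p%:R * x ^+ 2) 0).
  by rewrite fps_coef_natl -[x ^+ 2]mulr1 fps_coef_XnM /= mulr0 subr0 unitr1.
have gE : fps_geom int = (1 - x)^-1.
  by apply: (mulrI xU); rewrite divrr // fps_geomV.
have sE : \sum_(b < k) (p%:R * x ^+ 2) ^+ b =
    (1 - p%:R ^+ k * x ^+ (2 * k)) / (1 - p%:R * x ^+ 2).
  apply: (mulrI pxU); rewrite [RHS]mulrCA divrr // mulr1 exprM -exprMn.
  by apply: oppr_inj; rewrite -mulNr !opprB subrX1.
transitivity (fps_geom int *
    Fps (fun n => (\sum_(b < n.+1) tri_count p k (n - b) b)%:R)).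
  by apply: fpsP => n; rewrite fps_coef_geomM /= natr_sum.
rewrite fps_tri_count sE gE -/x div1r mulrDr; congr (_ + _).
  by rewrite mulrCA -expr2 exprVn.
by rewrite mulrCA -exprS exprVn.
Qed.
End TriangularSeries.

(** * The quotient ring *)

(** Reduction subtracts a multiple of the modulus, which vanishes at [z]. *)
Lemma horner_in_qpoly (A : comNzRingType) (h f : {poly A}) z :
  root (mk_monic h) z -> (in_qpoly h f : {poly A}).[z] = f.[z].
Proof.
move=> /rootP hz; rewrite /= [in RHS](Pdiv.RingMonic.rdivp_eq (monic_mk_monic h) f).
by rewrite hornerD hornerM hz mulr0 add0r.
Qed.

Section TriangularBasis.
Variables (p : nat) (p_pr : prime p) (k : nat).
Local Notation Zp := (zloc p_pr).
Local Notation P n := (p%:R ^+ n : Zp).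
Variables a b w a' b' w' : Zp.
Hypotheses (aa' : a * a' = 1) (bb' : b * b' = 1) (ww' : w * w' = 1).
Hypothesis abE : b - a = P k * w.
Local Notation h := ('X * ('X - a%:P) * ('X - b%:P)).
Local Notation R := {poly %/ h}.
Local Notation ev z x := ((x : {poly Zp}).[z]).

Lemma root_h0 : root (mk_monic h) 0.
Proof. by rewrite mk_monic_XXX /root !hornerE. Qed.

Lemma root_ha : root (mk_monic h) a.
Proof. by rewrite mk_monic_XXX /root !hornerE subrr mulr0 mul0r. Qed.

Lemma root_hb : root (mk_monic h) b.
Proof. by rewrite mk_monic_XXX /root !hornerE subrr mulr0. Qed.

Lemma size_qpoly (x : R) : (size (x : {poly Zp}) <= 3)%N.
Proof.
have h4 : size (mk_monic h) = 4%N.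
  rewrite mk_monic_XXX.
  rewrite size_Mmonic ?monicXsubC ?monic_neq0 ?monicMl ?monicX ?monicXsubC //.
  rewrite size_XsubC addn2 /= size_Mmonic ?monicXsubC ?monic_neq0 ?monicX //.
  by rewrite size_XsubC size_polyX.
by have := size_mk_monic x; rewrite [X in (_ < X)%N -> _]h4.
Qed.

Lemma horner_qpoly (x : R) z :
  ev z x = (x : {poly Zp})`_0 + (x : {poly Zp})`_1 * z + (x : {poly Zp})`_2 * z ^+ 2.
Proof.
by rewrite (horner_coef_wide _ (size_qpoly x)) !big_ord_recl
  big_ord0 /= mulr1 addr0 addrA.
Qed.

Lemma horner_qpolyM (x y : R) z : root (mk_monic h) z ->
  ev z (x * y) = ev z x * ev z y.
Proof. by move=> hz; rewrite -hornerM; apply: horner_in_qpoly. Qed.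

(** Once the constant terms agree, cancelling the units [a] and [b] leaves a linear polynomial
    vanishing at both. Subtracting its two values gives [p ^ k w (x2 - y2) = 0], where [w] and
    [p ^ k] cancel. *)
Lemma qpoly_eq (x y : R) :
  ev 0 x = ev 0 y -> ev a x = ev a y -> ev b x = ev b y -> x = y.
Proof.
rewrite !horner_qpoly !(mulr0, expr0n, addr0) => e0; rewrite e0.
set y0 := (y : {poly Zp})`_0; set x1 := (x : {poly Zp})`_1.
set x2 := (x : {poly Zp})`_2; set y1 := (y : {poly Zp})`_1.
set y2 := (y : {poly Zp})`_2 => ea eb.
have da : (x1 - y1) + (x2 - y2) * a = 0.
  transitivity (a * a' * ((x1 - y1) + (x2 - y2) * a)); first by rewrite aa' mul1r.
  transitivity (a' * ((y0 + x1 * a + x2 * a ^+ 2) - (y0 + y1 * a + y2 * a ^+ 2))).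
    by ring.
  by rewrite ea subrr mulr0.
have db : (x1 - y1) + (x2 - y2) * b = 0.
  transitivity (b * b' * ((x1 - y1) + (x2 - y2) * b)); first by rewrite bb' mul1r.
  transitivity (b' * ((y0 + x1 * b + x2 * b ^+ 2) - (y0 + y1 * b + y2 * b ^+ 2))).
    by ring.
  by rewrite eb subrr mulr0.
have e2 : x2 = y2.
  apply/subr0_eq/(zloc_mulfI (zloc_pX_neq0 p_pr k)); rewrite mulr0.
  transitivity (w' * (P k * w * (x2 - y2))).
    transitivity (w * w' * (P k * (x2 - y2))); first by rewrite ww' mul1r.
    by ring.
  transitivity (w' * ((x1 - y1 + (x2 - y2) * b) - (x1 - y1 + (x2 - y2) * a))).
    by rewrite -abE; ring.
  by rewrite da db subrr mulr0.
have e1 : x1 = y1 by apply: subr0_eq; rewrite e2 subrr mul0r addr0 in da.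
apply: val_inj; apply/polyP => -[|[|[|i]]] //.
by rewrite !nth_default // (leq_trans (size_qpoly _)).
Qed.

(* The polynomial of degree at most [2] with values [r], [s], [s + p ^ k q] at
   [0], [a], [b]. *)
Definition tri_elt r s q : R :=
  let c2 := b' * (w' * q - a' * (s - r)) in
  in_qpoly h (r%:P + (a' * (s - r) - a * c2) *: 'X + c2 *: 'X^2).

Lemma tri_elt_0 r s q : ev 0 (tri_elt r s q) = r.
Proof. by rewrite horner_in_qpoly ?root_h0 // !hornerE /= !(mulr0, addr0). Qed.

Lemma tri_elt_a r s q : ev a (tri_elt r s q) = s.
Proof.
rewrite horner_in_qpoly ?root_ha // !(hornerD, hornerC, hornerZ, hornerX, hornerXn).
transitivity (r + a * a' * (s - r)); first by ring.
by rewrite aa' mul1r subrKC.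
Qed.

Lemma tri_elt_b r s q : ev b (tri_elt r s q) = s + P k * q.
Proof.
rewrite horner_in_qpoly ?root_hb // !(hornerD, hornerC, hornerZ, hornerX, hornerXn).
(* Newton form: the polynomial is [r + a' (s - r) z + c2 z (z - a)], and the factor [b'] of [c2]
   cancels [b]. *)
transitivity (r + b * a' * (s - r) + b * b' * (b - a) * (w' * q - a' * (s - r))).
  by ring.
rewrite bb' mul1r.
transitivity (r + a * a' * (s - r) + (b - a) * w' * q); first by ring.
by rewrite aa' mul1r subrKC abE -(mulrA (P k)) ww' mulr1.
Qed.

Lemma tri_elt_inj r s q r' s' q' :
  tri_elt r s q = tri_elt r' s' q' -> [/\ r = r', s = s' & q = q'].
Proof.
move=> e; have rr' : r = r' by rewrite -(tri_elt_0 r s q) e tri_elt_0.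
have ss' : s = s' by rewrite -(tri_elt_a r s q) e tri_elt_a.
have := tri_elt_b r s q; rewrite e tri_elt_b ss'.
by move/addrI/(zloc_mulfI (zloc_pX_neq0 _ _)).
Qed.

Lemma tri_elt_surj x : exists r s q, x = tri_elt r s q.
Proof.
(* The last coordinate is [(f(b) - f(a)) / p ^ k], computed from [b ^ 2 - a ^ 2 = (b - a) (a + b)]
   and [b - a = p ^ k w]. *)
exists (ev 0 x), (ev a x), (w * ((x : {poly Zp})`_1 + (x : {poly Zp})`_2 * (a + b))).
apply: qpoly_eq; rewrite ?tri_elt_0 ?tri_elt_a ?tri_elt_b //.
rewrite mulrA -abE !horner_qpoly; ring.
Qed.

Lemma tri_eltD r s q r' s' q' :
  tri_elt r s q + tri_elt r' s' q' = tri_elt (r + r') (s + s') (q + q').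
Proof.
apply: qpoly_eq; rewrite hornerD ?tri_elt_0 ?tri_elt_a ?tri_elt_b //.
by ring.
Qed.

(** Values multiply pointwise; at [b], expanding [(s + p ^ k q) (s' + p ^ k q')] and removing [s s']
    leaves [p ^ k] times the third coordinate. *)
Lemma tri_eltM r s q r' s' q' :
  tri_elt r s q * tri_elt r' s' q' =
  tri_elt (r * r') (s * s') (s * q' + q * s' + P k * q * q').
Proof.
apply: qpoly_eq; rewrite horner_qpolyM ?tri_elt_0 ?tri_elt_a ?tri_elt_b //;
  [exact: root_h0 | exact: root_ha | ring | exact: root_hb].
Qed.

End TriangularBasis.

Theorem proposition4p1 (p : nat) (p_pr : prime p) (alpha beta : int) (k : nat) :
  alpha != 0 -> beta != 0 -> alpha != beta ->
  let Zp := zloc p_pr in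
  let a : Zp := alpha%:~R in
  let b : Zp := beta%:~R in
  let R := {poly %/ 'X * ('X - a%:P) * ('X - b%:P)} in
  let x := fpsX int in
  (zloc_ord a, zloc_ord b, zloc_ord (b - a)) = (0%N, 0%N, k) ->
  zeta_defined R p /\
  zeta R p =
    (1 - p%:R ^+ k * x ^+ (2 * k)) / (1 - p%:R * x ^+ 2) * (1 / (1 - x) ^+ 2)
    + p%:R ^+ k * x ^+ (2 * k) / (1 - x) ^+ 3.
Proof.
move=> alpha0 beta0 alpha_beta Zp a b R x [ord_a ord_b ord_ba].
have a0 : a != 0 by rewrite zloc_intr_eq0.
have b0 : b != 0 by rewrite zloc_intr_eq0.
have ba0 : b - a != 0 by rewrite -rmorphB zloc_intr_eq0 subr_eq0 eq_sym.
have [u [a' [aE ua']]] := zloc_ord_factor a0.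
have [v [b' [bE vb']]] := zloc_ord_factor b0.
have [w [w' [abE ww']]] := zloc_ord_factor ba0.
(* Order 0 makes [a] and [b] equal to their unit cofactors; only [b - a] keeps a power of [p]. *)
rewrite ord_a mul1r in aE; rewrite ord_b mul1r in bE; rewrite ord_ba in abE.
rewrite -aE in ua'; rewrite -bE in vb'.
pose inj := tri_elt_inj ua' vb' ww' abE; pose surj := tri_elt_surj ua' vb' ww' abE.
pose eD := tri_eltD ua' vb' ww' abE; pose eM := tri_eltM ua' vb' ww' abE.
split; first exact: zeta_defined_tri surj inj eD eM.
rewrite -tri_series; apply: fpsP => n /=.
by have [_ ->] := ideals_of_index_tri surj inj eD eM n.
Qed.
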